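(* Assume: (A1) $A$ and $B$ are continuously differentiable and there exist $L_A,L_B\in(0,\infty)$ such that for all $x,\hat x\in\mathbb R^n$, $u,\hat u\in\mathbb R^m$, $\|A(x,u)-A(\hat x,\hat u)\|\le L_A(\|x-\hat x\|+\|u-\hat u\|)$ and $\|B(x,u)-B(\hat x,\hat u)\|\le L_B(\|x-\hat x\|+\|u-\hat u\|)$; (A2) there exist $\bar a,\bar b\in(0,\infty)$ such that $\sup_{x,u}\|A(x,u)\|\le\bar a$ and $\sup_{x,u}\|B(x,u)\|\le\bar b$; (A3) with $A_0=A(0,0)$, $B_0=B(0,0)$, the pair $(A_0,B_0)$ is stabilizable and the pair $(A_0,Q^{1/2})$ is detectable; and that $Q$ is positive definite, $0\in\mathrm{int}\,\mathcal X$, and $0\in\mathrm{int}\,\mathcal U$. Consider the system $x_{k+1}=f(x_k,u_k)$ controlled by the iSCD-MPC algorithm with its stopping criterion and warm start. Furthermore, assume that, for all $k\in\mathbb N$, the applied sequence $U_{k|\rho_k}$ is feasible for ${\rm OCP}_k$ and, for all $k\in\{1,2,\ldots\}$, satisfies the descent condition $$\bar J_k(U_{k|\rho_k})\le\bar J_k\big(\mathcal S_{k-1}(U_{k-1|\rho_{k-1}})\big).$$ Then, for all $z_0\in\mathcal F_\ell$ such that $U_{0|\rho_0}$ is feasible for ${\rm OCP}_0$, $\lim_{k\to\infty}z_k=0$. If, in addition, there exists $c_V\in(0,\infty)$ such that, for all $z_0$ in a neighborhood of the origin, $\bar J_0(U_{0|\rho_0})\le c_V\|z_0\|^2$, then the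 equilibrium $z=0$ of the closed-loop dynamics is asymptotically stable.
   Context: $\mathbb N=\{0,1,2,\ldots\}$; $\|\cdot\|$ is the Euclidean norm on vectors and the induced norm on matrices. System: $f(x,u)=A(x,u)x+B(x,u)u$ for all $x\in\mathbb R^n$, $u\in\mathbb R^m$, with $A:\mathbb R^n\times\mathbb R^m\to\mathbb R^{n\times n}$, $B:\mathbb R^n\times\mathbb R^m\to\mathbb R^{n\times m}$; $x_0,u_0$ are given. $\mathcal X\subseteq\mathbb R^n$, $\mathcal U\subseteq\mathbb R^m$ are closed (described by finitely many affine equalities and inequalities). Horizon $\ell\ge2$. $Q\in\mathbb R^{n\times n}$, $R\in\mathbb R^{m\times m}$ are symmetric, $R$ positive definite. The extended state is $z_k=(x_k,u_k)\in\mathbb R^{n+m}$; the closed-loop dynamics are $z_{k+1}=(f(x_k,u_k),u_{k,1|\rho_k})$ with $u_{k,1|\rho_k}$ from the algorithm below. Terminal ingredients: $P$ is the unique (positive definite) stabilizing solution of $P=A_0^TPA_0-A_0^TPB_0(2R+B_0^TPB_0)^{-1}B_0^TPA_0+2Q$; $K_{\rm f}=-(2R+B_0^TPB_0)^{-1}B_0^TPA_0$; $\kappa_{\rm f}(x)=K_{\rm f}x$; $V_{\rm f}(x)=x^TPx$; and $\mathcal X_{\rm f}=\{x:V_{\rm f}(x)\le\alpha\}$, where $\alpha\in(0,\infty)$ is such that (i) $\mathcal X_{\rm f}\subseteq\mathcal X$ and $\kappa_{\rm f}(x)\in\mathcal U$ for all $x\in\mathcal X_{\rm f}$; (ii) $f(x,\kappa_{\rm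 f}(x))\in\mathcal X_{\rm f}$ for all $x\in\mathcal X_{\rm f}$; (iii) $V_{\rm f}(f(x,\kappa_{\rm f}(x)))-V_{\rm f}(x)\le-x^TQx-\kappa_{\rm f}(x)^TR\kappa_{\rm f}(x)$ for all $x\in\mathcal X_{\rm f}$. (Under the stated assumptions such an $\alpha$ exists.) ${\rm OCP}_k$: with $x_{k,1}=f(x_k,u_k)$, minimize over $U=(u_1,\ldots,u_{\ell-1})$ the rollout cost $\bar J_k(U)=\tfrac12x_\ell^TPx_\ell+\tfrac12\sum_{j=1}^{\ell-1}(x_j^TQx_j+u_j^TRu_j)$, where $x_1=x_{k,1}$, $x_{j+1}=f(x_j,u_j)$, subject to $x_j\in\mathcal X$ ($1\le j\le\ell$), $u_j\in\mathcal U$ ($1\le j\le\ell-1$), $x_\ell\in\mathcal X_{\rm f}$. $U$ is feasible for ${\rm OCP}_k$ if it satisfies these constraints. $\mathcal F_\ell$ is the set of $(x,u)\in\mathbb R^{n+m}$ for which there exist $u_1,\ldots,u_{\ell-1}\in\mathcal U$ such that, with $x_1=f(x,u)$, $x_{j+1}=f(x_j,u_j)$, one has $x_j\in\mathcal X$ for $1\le j\le\ell-1$ and $x_\ell\in\mathcal X_{\rm f}$. Shifted candidate: for $U=(u_1,\ldots,u_{\ell-1})$ feasible for ${\rm OCP}_k$, with trajectory $x_1,\ldots,x_\ell$ defined by $x_1=x_{k,1}$ and $x_{j+1}=f(x_j,u_j)$ for $1\le j\le\ell-1$, $\mathcal S_k(U)=(u_2,\ldots,u_{\ell-1},\kappa_{\rm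 f}(x_\ell))$, a control sequence for ${\rm OCP}_{k+1}$. iSCD-MPC algorithm (maximum iteration number $\rho\ge1$, tolerance $\varepsilon>0$). At step $k$, given $(x_k,u_k)$, set $x_{k,1}=f(x_k,u_k)$. A sequence $U_{k|i}=(u_{k,1|i},\ldots,u_{k,\ell-1|i})$ generates the rollout $x_{k,1|i}=x_{k,1}$, $x_{k,j+1|i}=f(x_{k,j|i},u_{k,j|i})$, with coefficients $A_{k,j|i}=A(x_{k,j|i},u_{k,j|i})$, $B_{k,j|i}=B(x_{k,j|i},u_{k,j|i})$. Initialization: $u_{0,j|1}=u_0$ for all $j$; warm start for $k\ge1$: $u_{k,j|1}=u_{k-1,j+1|\rho_{k-1}}$ for $j\le\ell-2$ and $u_{k,\ell-1|1}=\kappa_{\rm f}(x_{k,\ell-1|1})$ (that is, $U_{k|1}=\mathcal S_{k-1}(U_{k-1|\rho_{k-1}})$). For $i\ge2$, $U_{k|i}$ is the minimizer $(\mu_1,\ldots,\mu_{\ell-1})$ of $\tfrac12\xi_\ell^TP\xi_\ell+\tfrac12\sum_{j=1}^{\ell-1}(\xi_j^TQ\xi_j+\mu_j^TR\mu_j)$ subject to $\xi_1=x_{k,1}$, $\xi_{j+1}=A_{k,j|i-1}\xi_j+B_{k,j|i-1}\mu_j$ ($1\le j\le\ell-1$), $\xi_j\in\mathcal X$ ($1\le j\le\ell$), $\mu_j\in\mathcal U$ ($1\le j\le\ell-1$). The iteration stops at $\rho_k=\min\{\rho,\min\{i\in\{2,\ldots,\rho\}:\|U_{k|i}-U_{k|i-1}\|<\varepsilon\}\}$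 (inner minimum equal to $\rho$ if the tolerance is never met), and the applied control is $u_{k+1}=u_{k,1|\rho_k}$. *)

(* Defs.v *)
From HB Require Import structures.
From mathcomp Require Import all_boot all_order all_algebra.
From mathcomp Require Import complex.
From mathcomp Require Import all_classical all_reals all_analysis.

Set Implicit Arguments.
Unset Strict Implicit.
Unset Printing Implicit Defensive.

Import Order.TTheory GRing.Theory Num.Theory.
Import numFieldNormedType.Exports.

Local Open Scope classical_set_scope.
Local Open Scope ring_scope.

(* The library norm [`|_|] on matrices is the max-norm, hence [enorm] and
   [opnorm] for the Euclidean norm and the matrix norm it induces. *)
Definition enorm (R : realType) n (x : 'cV[R]_n) : R :=
  Num.sqrt (\sum_(i < n) x i 0 ^+ 2).

Definition opnorm (R : realType) n m (M : 'M[R]_(n, m)) : R :=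
  sup [set enorm (M *m v) | v in [set v : 'cV[R]_m | enorm v <= 1]].

Definition pair_norm (R : realType) n m (z : 'cV[R]_n * 'cV[R]_m) : R :=
  enorm (col_mx z.1 z.2).

(* Euclidean norm of the stacked vector (u_1, ..., u_N). *)
Definition seq_dist (R : realType) m N (U V : N.-tuple 'cV[R]_m) : R :=
  Num.sqrt (\sum_(j < N) enorm (tnth U j - tnth V j) ^+ 2).

Definition qform (R : realType) n (M : 'M[R]_n) (x : 'cV[R]_n) : R :=
  (x^T *m M *m x) 0 0.

Definition symmetric_mx (R : realType) n (M : 'M[R]_n) : Prop := M^T = M.

Definition posdef (R : realType) n (M : 'M[R]_n) : Prop :=
  symmetric_mx M /\ forall x : 'cV[R]_n, x != 0 -> 0 < qform M x.

Definition possemidef (R : realType) n (M : 'M[R]_n) : Prop :=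
  symmetric_mx M /\ forall x : 'cV[R]_n, 0 <= qform M x.

(* [S] is the principal square root M^{1/2}. *)
Definition is_sqrt_mx (R : realType) n (M S : 'M[R]_n) : Prop :=
  possemidef S /\ S *m S = M.

Definition schur_stable (R : realType) n (M : 'M[R]_n) : Prop :=
  forall l : R[i], eigenvalue (map_mx (real_complex R) M) l -> `|l| < 1.

Definition stabilizable (R : realType) n m
    (A : 'M[R]_n) (B : 'M[R]_(n, m)) : Prop :=
  exists K : 'M[R]_(m, n), schur_stable (A + B *m K).

Definition detectable (R : realType) n p
    (A : 'M[R]_n) (C : 'M[R]_(p, n)) : Prop :=
  exists L : 'M[R]_(n, p), schur_stable (A + L *m C).

Definition polyhedral (R : realType) n (X : set 'cV[R]_n) : Prop :=
  exists (p q : nat) (E : 'M[R]_(p, n)) (e : 'cV[R]_p)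
         (G : 'M[R]_(q, n)) (g : 'cV[R]_q),
    X = [set x | E *m x = e /\ forall i, (G *m x) i 0 <= g i 0].

(* ['d F p] has no library topology of its own; in finite dimension its
   continuity in p amounts to that of every directional derivative. *)
Definition C1 (R : realType) (V W : normedModType R) (F : V -> W) : Prop :=
  (forall p, differentiable F p) /\ forall v, continuous (fun p => 'd F p v).

Definition lipschitz_coef (R : realType) n m q
    (F : 'cV[R]_n * 'cV[R]_m -> 'M[R]_(n, q)) (L : R) : Prop :=
  forall x x' u u',
    opnorm (F (x, u) - F (x', u')) <= L * (enorm (x - x') + enorm (u - u')).

Record mpc_data (R : realType) (n m : nat) := MpcData {
  sysA : 'cV[R]_n * 'cV[R]_m -> 'M[R]_n;
  sysB : 'cV[R]_n * 'cV[R]_m -> 'M[R]_(n, m);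
  stateset : set 'cV[R]_n;
  inputset : set 'cV[R]_m;
  Qw : 'M[R]_n;
  Rw : 'M[R]_m;
  Pf : 'M[R]_n;
  alpha : R;
  ell : nat;       (* horizon *)
  maxit : nat;     (* maximum iteration number rho *)
  tol : R          (* tolerance epsilon *)
}.

Section MPC.
Context {R : realType} {n m : nat} (S : mpc_data R n m).

Definition dyn (z : 'cV[R]_n * 'cV[R]_m) : 'cV[R]_n :=
  sysA S z *m z.1 + sysB S z *m z.2.

Definition A0 : 'M[R]_n := sysA S (0, 0).
Definition B0 : 'M[R]_(n, m) := sysB S (0, 0).

Definition riccati_inv : 'M[R]_m :=
  invmx (2%:R *: Rw S + B0^T *m Pf S *m B0).

Definition Kf : 'M[R]_(m, n) := - (riccati_inv *m B0^T *m Pf S *m A0).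

Definition stabilizing_riccati_solution : Prop :=
  [/\ posdef (Pf S),
      Pf S = A0^T *m Pf S *m A0
             - A0^T *m Pf S *m B0 *m riccati_inv *m B0^T *m Pf S *m A0
             + 2%:R *: Qw S
    & schur_stable (A0 + B0 *m Kf)].

Definition kappaf (x : 'cV[R]_n) : 'cV[R]_m := Kf *m x.
Definition Vf (x : 'cV[R]_n) : R := qform (Pf S) x.
Definition Xf : set 'cV[R]_n := [set x | Vf x <= alpha S].

Definition terminal_conditions : Prop :=
  [/\ 0 < alpha S,
      forall x, Xf x -> stateset S x /\ inputset S (kappaf x),
      forall x, Xf x -> Xf (dyn (x, kappaf x))
    & forall x, Xf x ->
        Vf (dyn (x, kappaf x)) - Vf x
          <= - qform (Qw S) x - qform (Rw S) (kappaf x)].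

(* Control sequences (u_1, ..., u_{ell-1}) are tuples of length [ell - 1], read
   as sequences indexed from 0: [U`_j] is u_{j+1}; likewise [rollout x1 U j] and
   [ltv_rollout x1 V W j] are x_{j+1} and xi_{j+1}. *)
Definition controls := ((ell S).-1.-tuple 'cV[R]_m)%type.

Fixpoint rollout (x1 : 'cV[R]_n) (U : seq 'cV[R]_m) (j : nat) : 'cV[R]_n :=
  if j is j'.+1 then dyn (rollout x1 U j', U`_j') else x1.

(* Response to [W] of the linear time-varying system whose coefficients are
   frozen along the rollout of [V]. *)
Fixpoint ltv_rollout (x1 : 'cV[R]_n) (V W : seq 'cV[R]_m) (j : nat)
    : 'cV[R]_n :=
  if j is j'.+1 then
    sysA S (rollout x1 V j', V`_j') *m ltv_rollout x1 V W j'
    + sysB S (rollout x1 V j', V`_j') *m W`_j'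
  else x1.

Definition traj_cost (x : nat -> 'cV[R]_n) (U : seq 'cV[R]_m) : R :=
  2%:R^-1 * qform (Pf S) (x (ell S).-1)
  + 2%:R^-1 * \sum_(0 <= j < (ell S).-1)
                (qform (Qw S) (x j) + qform (Rw S) U`_j).

Definition traj_constraints (x : nat -> 'cV[R]_n) (U : seq 'cV[R]_m) : Prop :=
  (forall j, (j <= (ell S).-1)%N -> stateset S (x j)) /\
  (forall j, (j < (ell S).-1)%N -> inputset S U`_j).

Definition Jbar (x1 : 'cV[R]_n) (U : seq 'cV[R]_m) : R :=
  traj_cost (rollout x1 U) U.

Definition feasible (x1 : 'cV[R]_n) (U : controls) : Prop :=
  traj_constraints (rollout x1 U) U /\ Xf (rollout x1 U (ell S).-1).

Definition Fset : set ('cV[R]_n * 'cV[R]_m) :=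
  [set z | exists U : controls,
     [/\ forall j, (j < (ell S).-1)%N -> inputset S U`_j,
         forall j, (j < (ell S).-1)%N -> stateset S (rollout (dyn z) U j)
       & Xf (rollout (dyn z) U (ell S).-1)]].

Definition shifted (x1 : 'cV[R]_n) (U : seq 'cV[R]_m) : seq 'cV[R]_m :=
  rcons (behead U) (kappaf (rollout x1 U (ell S).-1)).

Definition subproblem_minimizer (x1 : 'cV[R]_n) (V W : controls) : Prop :=
  traj_constraints (ltv_rollout x1 V W) W /\
  forall W' : controls, traj_constraints (ltv_rollout x1 V W') W' ->
    traj_cost (ltv_rollout x1 V W) W <= traj_cost (ltv_rollout x1 V W') W'.

(* rho_k, as a function of the iterates [i |-> U_{k|i}]; the value depends on
   the iterates up to the stopping index only. *)
Definition stop_index (Uk : nat -> controls) : nat :=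
  \big[minn/maxit S]_(2 <= i < (maxit S).+1
                       | seq_dist (Uk i) (Uk i.-1) < tol S) i.

Definition applied (U : nat -> nat -> controls) (k : nat) : controls :=
  U k (stop_index (U k)).

(* [U k i] is U_{k|i}; it is meaningful, and constrained, for
   1 <= i <= rho_k only. *)
Record closed_loop (x : nat -> 'cV[R]_n) (u : nat -> 'cV[R]_m)
    (U : nat -> nat -> controls) : Prop := ClosedLoop {
  cl_state : forall k, x k.+1 = dyn (x k, u k);
  cl_input : forall k, u k.+1 = (applied U k)`_0;
  cl_init : U 0%N 1%N = nseq (ell S).-1 (u 0%N) :> seq _;
  cl_warm : forall k,
    U k.+1 1%N = shifted (dyn (x k, u k)) (applied U k) :> seq _;
  cl_iter : forall k i, (2 <= i <= stop_index (U k))%N ->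
    subproblem_minimizer (dyn (x k, u k)) (U k i.-1) (U k i)
}.

Definition feasible_at (x : nat -> 'cV[R]_n) (u : nat -> 'cV[R]_m)
    (U : nat -> nat -> controls) (k : nat) : Prop :=
  feasible (dyn (x k, u k)) (applied U k).

Definition descent_at (x : nat -> 'cV[R]_n) (u : nat -> 'cV[R]_m)
    (U : nat -> nat -> controls) (k : nat) : Prop :=
  Jbar (dyn (x k, u k)) (applied U k)
    <= Jbar (dyn (x k, u k)) (shifted (dyn (x k.-1, u k.-1)) (applied U k.-1)).

Definition feasible_with_descent (x : nat -> 'cV[R]_n) (u : nat -> 'cV[R]_m)
    (U : nat -> nat -> controls) : Prop :=
  (forall k, feasible_at x u U k) /\
  (forall k, (1 <= k)%N -> descent_at x u U k).

Definition converges_to_0 (x : nat -> 'cV[R]_n) (u : nat -> 'cV[R]_m) : Prop :=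
  (fun k => (x k, u k)) @ \oo --> ((0, 0) : 'cV[R]_n * 'cV[R]_m).

(* Taking x 0 = 0 and u 0 = 0, the first clause contains that 0 is an
   equilibrium. *)
Definition asymptotically_stable : Prop :=
  (forall e : R, 0 < e -> exists2 d : R, 0 < d &
     forall x u U, closed_loop x u U -> pair_norm (x 0%N, u 0%N) < d ->
       forall k, pair_norm (x k, u k) < e) /\
  (exists2 d : R, 0 < d &
     forall x u U, closed_loop x u U -> pair_norm (x 0%N, u 0%N) < d ->
       converges_to_0 x u).

End MPC.

(* Main.v *)
Require Import Defs.
From HB Require Import structures.
From mathcomp Require Import all_boot all_order all_algebra.
From mathcomp Require Import all_classical all_reals all_analysis.
From mathcomp Require Import ring lra.
Import Order.TTheory GRing.Theory Num.Theory.
Import numFieldNormedType.Exports.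
Local Open Scope classical_set_scope.
Local Open Scope ring_scope.

(** The optimal-control cost is a Lyapunov function.  Write
    [J k := Jbar S (dyn S z_k) (applied U k)] with [z_k = (x_k, u_k)].  The
    first stage of that cost is paid at [(dyn S z_k, u_{k+1}) = z_{k+1}]
    ([next_state_inputE]).  The shifted sequence drops this stage and appends
    one step of the terminal controller, which costs no more than the decrease
    of the terminal cost, by the last of the terminal conditions; hence it costs
    at most [J k] minus half the stage cost of [z_{k+1}] ([Jbar_shifted_le]), and
    the descent condition gives
      [J k.+1 <= J k - 1/2 stage_cost S z_{k+1}]   ([J_decreases]).
    Since [J] is nonincreasing and nonnegative it converges, so the stage costs
    tend to 0; they dominate a multiple of the squared Euclidean norm of
    [z_{k+1}], because both weights are positive definite
    ([stage_cost_coercive]).  This yields [closed_loop_cvg0].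

    For asymptotic stability, a cost below some threshold forces every state
    and input of the rollout into the neighbourhoods of 0 contained in the
    constraint sets, and the last state into the terminal set
    ([feasible_of_Jbar_lt]).  The quadratic bound on the initial cost therefore
    makes the initial sequence feasible for all small [z_0]; feasibility and
    descent at all later steps then hold by assumption, hence attractivity.  Stability
    follows from
      [|z_{k+1}|^2 <= c * stage_cost S z_{k+1} <= 2 c * J k
                   <= 2 c * J 0 <= 2 c * cV * |z_0|^2]. *)

Set Implicit Arguments.
Unset Strict Implicit.
Unset Printing Implicit Defensive.

(** * Euclidean norms *)

Lemma enorm_ge0 (R : realType) n (x : 'cV[R]_n) : 0 <= enorm x.
Proof. exact: sqrtr_ge0. Qed.

Lemma enorm_sqr (R : realType) n (x : 'cV[R]_n) :
  enorm x ^+ 2 = \sum_(i < n) x i 0 ^+ 2.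
Proof. by rewrite sqr_sqrtr// sumr_ge0// => i _; exact: sqr_ge0. Qed.

(** Together with [norm_le_pair_norm], transfers Euclidean estimates to the
    topology, which is that of the max-norm. *)
Lemma norm_le_enorm (R : realType) n (x : 'cV[R]_n) : `|x| <= enorm x.
Proof.
rewrite [`|x|]mx_normrE.
apply: bigmax_le => [|[i j] _ /=]; first exact: enorm_ge0.
rewrite (ord1 j) -ler_sqr ?nnegrE ?enorm_ge0// enorm_sqr real_normK ?num_real//.
by rewrite (bigD1 i)//= lerDl sumr_ge0// => k _; exact: sqr_ge0.
Qed.

Lemma pair_norm_ge0 (R : realType) n m (z : 'cV[R]_n * 'cV[R]_m) :
  0 <= pair_norm z.
Proof. exact: enorm_ge0. Qed.

Lemma pair_norm_sqr (R : realType) n m (z : 'cV[R]_n * 'cV[R]_m) :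
  pair_norm z ^+ 2 = enorm z.1 ^+ 2 + enorm z.2 ^+ 2.
Proof.
rewrite !enorm_sqr big_split_ord /=; congr (_ + _).
  by apply: eq_bigr => i _; rewrite col_mxEu.
by apply: eq_bigr => i _; rewrite col_mxEd.
Qed.

Lemma enorm_fst_le_pair_norm (R : realType) n m (z : 'cV[R]_n * 'cV[R]_m) :
  enorm z.1 <= pair_norm z.
Proof.
by rewrite -ler_sqr ?nnegrE ?enorm_ge0// pair_norm_sqr lerDl sqr_ge0.
Qed.

Lemma enorm_snd_le_pair_norm (R : realType) n m (z : 'cV[R]_n * 'cV[R]_m) :
  enorm z.2 <= pair_norm z.
Proof.
by rewrite -ler_sqr ?nnegrE ?enorm_ge0// pair_norm_sqr lerDr sqr_ge0.
Qed.

Lemma norm_le_pair_norm (R : realType) n m (z : 'cV[R]_n * 'cV[R]_m) :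
  `|z| <= pair_norm z.
Proof.
rewrite prod_normE ge_max.
rewrite (le_trans (norm_le_enorm _) (enorm_fst_le_pair_norm _))/=.
exact: le_trans (norm_le_enorm _) (enorm_snd_le_pair_norm _).
Qed.

Lemma ball_pair_norm (R : realType) n m (P : set ('cV[R]_n * 'cV[R]_m)) :
  (\forall z \near nbhs ((0, 0) : 'cV[R]_n * 'cV[R]_m), P z) ->
  exists2 d : R, 0 < d & forall z, pair_norm z < d -> P z.
Proof.
move=> /nbhs_normP[d /= d0 ballP]; exists d => // z zd.
apply: ballP; rewrite /ball_ /= distrC subr0.
exact: le_lt_trans (norm_le_pair_norm _) zd.
Qed.

(** * Positive definite matrices *)

Lemma posdef_ge0 (R : realType) n (M : 'M[R]_n) (x : 'cV[R]_n) :
  posdef M -> 0 <= qform M x.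
Proof.
case=> _ M_gt0; have [->|/M_gt0/ltW//] := eqVneq x 0.
by rewrite /qform mulmx0 mxE.
Qed.

(** The quadratic form would vanish at any row vector of the kernel. *)
Lemma posdef_unitmx (R : realType) n (M : 'M[R]_n) : posdef M -> M \in unitmx.
Proof.
case=> _ M_gt0; rewrite -row_free_unit -kermx_eq0; apply/eqP/row_matrixP => i.
rewrite row0; apply/eqP; apply: contraT => k_neq0.
have : 0 < qform M (row i (kermx M))^T.
  by apply: M_gt0; rewrite -(inj_eq (@trmx_inj _ _ _)) trmxK trmx0.
rewrite /qform trmxK -row_mul mulmx_ker row0 mul0mx mxE.
by rewrite ltxx.
Qed.

Lemma qformBZ (R : realType) n (M : 'M[R]_n) (x y : 'cV[R]_n) (t : R) :
  symmetric_mx M ->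
  qform M (x - t *: y)
    = qform M x - 2 * t * (x^T *m M *m y) 0 0 + t ^+ 2 * qform M y.
Proof.
move=> symM.
have yMx : (y^T *m M *m x) 0 0 = (x^T *m M *m y) 0 0.
  by rewrite -[LHS](mxE trmx_key (fun i j => (y^T *m M *m x) j i))
             -/(trmx _) !trmx_mul trmxK symM mulmxA.
have xtyT : (x - t *: y)^T = x^T - t *: y^T.
  by apply/matrixP => i j; rewrite !mxE.
rewrite {1}/qform xtyT !(mulmxBl, mulmxBr) -!scalemxAl -!scalemxAr.
(* The four products become opaque matrices, lest [mxE] unfold them to sums. *)
move: yMx; rewrite /qform.
move: (x^T *m M *m x) (x^T *m M *m y) (y^T *m M *m x) (y^T *m M *m y).
move=> a b c d cb; rewrite !mxE cb; ring.
Qed.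

(** With [y_i := M^-1 e_i], the scalar product defined by [M] satisfies
    [<x, y_i> = x_i], so its Cauchy-Schwarz inequality reads
    [x_i^2 <= <y_i, y_i> <x, x>]; summing over [i] bounds the Euclidean
    norm. *)
Lemma posdef_coercive (R : realType) n (M : 'M[R]_n) :
  posdef M ->
  exists2 c : R, 0 < c & forall x : 'cV[R]_n, enorm x ^+ 2 <= c * qform M x.
Proof.
move=> M_pos; have [symM M_gt0] := M_pos.
pose y (i : 'I_n) : 'cV[R]_n := invmx M *m delta_mx i 0.
have My i : M *m y i = delta_mx i 0.
  by rewrite mulmxA mulmxV ?mul1mx// posdef_unitmx.
have qy i : 0 < qform M (y i).
  apply: M_gt0; apply: contraTneq isT => yi0.
  have := congr1 (fun v : 'cV_n => v i 0) (My i).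
  by rewrite yi0 mulmx0 !mxE !eqxx => /esym/eqP; rewrite oner_eq0.
have entry i (x : 'cV[R]_n) : x i 0 ^+ 2 <= qform M (y i) * qform M x.
  have xMy : (x^T *m M *m y i) 0 0 = x i 0.
    rewrite -mulmxA My mxE (bigD1 i)//= big1 ?addr0 => [|j /negbTE ji];
      by rewrite !mxE ?eqxx ?ji ?mulr1 ?mulr0.
  (* Cauchy-Schwarz: nonnegativity at the minimizer in [t] of [x - t y_i]. *)
  have := posdef_ge0 (x - (x i 0 / qform M (y i)) *: y i) M_pos.
  rewrite qformBZ// xMy.
  move: (qform M (y i)) (qy i) => c c0.
  have -> : qform M x - 2 * (x i 0 / c) * x i 0 + (x i 0 / c) ^+ 2 * c
          = qform M x - x i 0 ^+ 2 / c by field; exact: lt0r_neq0.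
  by rewrite subr_ge0 ler_pdivrMr// mulrC.
(* The summand 1 keeps the constant positive when [n = 0]. *)
exists (1 + \sum_i qform M (y i)) => [|x].
  by rewrite ltr_wpDr// sumr_ge0// => i _; exact: ltW.
rewrite enorm_sqr mulrDl mul1r mulr_suml -[leLHS]add0r lerD ?posdef_ge0//.
exact: ler_sum.
Qed.

(** * The cost of a control sequence and of its shift *)

Definition stage_cost (R : realType) n m (S : mpc_data R n m)
    (z : 'cV[R]_n * 'cV[R]_m) : R :=
  qform (Qw S) z.1 + qform (Rw S) z.2.

Section Lyapunov.
Context (R : realType) (n m : nat) (S : mpc_data R n m).
Context (ell_ge2 : (2 <= ell S)%N) (Q_pos : posdef (Qw S)).
Context (R_pos : posdef (Rw S)) (P_pos : posdef (Pf S)).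
Context (term : terminal_conditions S).

Lemma stage_cost_ge0 z : 0 <= stage_cost S z.
Proof. by rewrite addr_ge0// posdef_ge0. Qed.

Lemma stage_cost_coercive :
  exists2 c : R, 0 < c & forall z, pair_norm z ^+ 2 <= c * stage_cost S z.
Proof.
have [a a0 Ha] := posdef_coercive Q_pos.
have [b b0 Hb] := posdef_coercive R_pos.
exists (a + b) => [|z]; first exact: addr_gt0.
rewrite pair_norm_sqr /stage_cost.
have := Ha z.1; have := Hb z.2.
have := posdef_ge0 z.1 Q_pos; have := posdef_ge0 z.2 R_pos.
nra.
Qed.

Lemma stage_cost_le_Jbar x1 (U : seq 'cV[R]_m) j : (j < (ell S).-1)%N ->
  stage_cost S (rollout S x1 U j, U`_j) <= 2 * Jbar S x1 U.
Proof.
move=> jN; rewrite /Jbar /traj_cost -mulrDr mulrA divff// mul1r.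
rewrite big_mkord (bigD1 (Ordinal jN))//= addrCA lerDl addr_ge0 ?posdef_ge0//.
by rewrite sumr_ge0// => i _; exact: (stage_cost_ge0 (_, _)).
Qed.

Lemma Vf_le_Jbar x1 (U : seq 'cV[R]_m) :
  Vf S (rollout S x1 U (ell S).-1) <= 2 * Jbar S x1 U.
Proof.
rewrite /Jbar /traj_cost -mulrDr mulrA divff// mul1r lerDl.
by rewrite big_mkord sumr_ge0// => i _; exact: (stage_cost_ge0 (_, _)).
Qed.

Lemma Jbar_ge0 x1 (U : seq 'cV[R]_m) : 0 <= Jbar S x1 U.
Proof.
rewrite -(pmulr_rge0 _ (ltr0Sn R 1)).
by rewrite (le_trans _ (Vf_le_Jbar x1 U))// posdef_ge0.
Qed.

Lemma nth_shifted x1 (U : seq 'cV[R]_m) j : size U = (ell S).-1 ->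
  (j.+1 < (ell S).-1)%N ->
  (shifted S x1 U)`_j = U`_j.+1.
Proof.
by move=> sU jN; rewrite nth_rcons nth_behead size_behead sU ltn_predRL jN.
Qed.

Lemma nth_shifted_last x1 (U : seq 'cV[R]_m) : size U = (ell S).-1 ->
  (shifted S x1 U)`_(ell S).-2 = kappaf S (rollout S x1 U (ell S).-1).
Proof. by move=> sU; rewrite nth_rcons size_behead sU ltnn eqxx. Qed.

Lemma rollout_shifted x1 (U : seq 'cV[R]_m) j : size U = (ell S).-1 ->
  (j < (ell S).-1)%N ->
  rollout S (dyn S (x1, U`_0)) (shifted S x1 U) j = rollout S x1 U j.+1.
Proof.
move=> sU; elim: j => [//|j IH] jN.
by rewrite [LHS]/= IH ?(ltnW jN)// nth_shifted.
Qed.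

(** The two rollouts share all their stages except the first stage of [U] and
    the terminal-controller stage appended by the shift. *)
Lemma Jbar_shifted x1 (U : seq 'cV[R]_m) : size U = (ell S).-1 ->
  let xN := rollout S x1 U (ell S).-1 in
  let uN := kappaf S xN in
  Jbar S (dyn S (x1, U`_0)) (shifted S x1 U)
    = Jbar S x1 U - 2^-1 * stage_cost S (x1, U`_0)
      + 2^-1 * (Vf S (dyn S (xN, uN)) - Vf S xN + stage_cost S (xN, uN)).
Proof.
move=> sU xN uN.
have [N NE] : exists N, (ell S).-1 = N.+1.
  by exists (ell S).-2; rewrite prednK// -ltnS prednK// ltnW.
have costE x0 V : Jbar S x0 V = 2^-1 * Vf S (rollout S x0 V N.+1)
    + 2^-1 * \sum_(0 <= j < N.+1) stage_cost S (rollout S x0 V j, V`_j).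
  by rewrite /Jbar /traj_cost NE.
have tail j : (j <= N)%N ->
    rollout S (dyn S (x1, U`_0)) (shifted S x1 U) j = rollout S x1 U j.+1.
  by move=> jN; rewrite rollout_shifted// NE.
have last : (shifted S x1 U)`_N = uN.
  by rewrite -[N]/N.+1.-1 -NE nth_shifted_last.
have xNE : rollout S x1 U N.+1 = xN by rewrite /xN NE.
(* Split the last stage off the sum for the shifted sequence and the first stage
   off the sum for [U]: the remaining stages coincide. *)
rewrite !costE big_nat_recr//= big_nat_recl//= tail// last.
rewrite -/(rollout S x1 U N.+1) xNE.
rewrite (eq_big_nat _ _ (F2 := fun j =>
  stage_cost S (rollout S x1 U j.+1, U`_j.+1))) => [|j /andP[_ jN]]; last first.
  by rewrite tail 1?ltnW// nth_shifted// NE.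
ring.
Qed.

(** Along the terminal controller the terminal cost drops by at least the stage
    cost, so the stage appended by the shift is already paid for. *)
Lemma Jbar_shifted_le x1 (U : controls S) : feasible x1 U ->
  Jbar S (dyn S (x1, U`_0)) (shifted S x1 U)
    <= Jbar S x1 U - 2^-1 * stage_cost S (x1, U`_0).
Proof.
move=> [_ xNf]; have [_ _ _ Vf_decr] := term.
have := Vf_decr _ xNf; rewrite Jbar_shifted ?size_tuple// /stage_cost /=; lra.
Qed.

(** Every stage cost and the terminal cost are at most twice the total cost;
    by coercivity a small total cost puts each stage in a small ball around 0,
    and the last state in a small sublevel set of the terminal cost. *)
Lemma feasible_of_Jbar_lt :
  interior (stateset S) 0 -> interior (inputset S) 0 ->
  exists2 r : R, 0 < r &
    forall x1 (U : controls S), Jbar S x1 U < r -> feasible x1 U.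
Proof.
move=> /nbhs_normP[dX /= dX0 ballX] /nbhs_normP[dU /= dU0 ballU].
have [alpha0 XfX _ _] := term.
have [c c0 coer] := stage_cost_coercive.
pose d := Num.min dX dU.
have d0 : 0 < d by rewrite lt_min dX0.
exists (Num.min (d ^+ 2 / (2 * c)) (alpha S / 2)) => [|x1 U].
  by rewrite lt_min !divr_gt0 ?exprn_gt0 ?mulr_gt0.
rewrite lt_min !ltr_pdivlMr ?mulr_gt0// => /andP[Jd Jalpha].
have xNf : Xf S (rollout S x1 U (ell S).-1).
  rewrite /Xf /= (le_trans (Vf_le_Jbar _ _))// mulrC; exact: ltW.
have small j : (j < (ell S).-1)%N -> pair_norm (rollout S x1 U j, U`_j) < d.
  move=> jN; rewrite -ltr_sqr ?nnegrE ?pair_norm_ge0 ?(ltW d0)//.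
  rewrite (le_lt_trans (coer _))// (le_lt_trans _ Jd)//.
  have -> : Jbar S x1 U * (2 * c) = c * (2 * Jbar S x1 U) by ring.
  by rewrite ler_pM2l// stage_cost_le_Jbar.
split=> //; split=> j jN.
  (* The last state carries no stage cost: it is admissible as a point of the
     terminal set. *)
  have [->|jltN] := eqVneq j (ell S).-1; first exact: (XfX _ xNf).1.
  apply: ballX; rewrite /ball_ /= sub0r normrN.
  have jN' : (j < (ell S).-1)%N by rewrite ltn_neqAle jltN.
  rewrite (le_lt_trans (norm_le_enorm _))//.
  rewrite (le_lt_trans (enorm_fst_le_pair_norm (rollout S x1 U j, U`_j)))//.
  by rewrite (lt_le_trans (small j jN'))// ge_min lexx.
apply: ballU; rewrite /ball_ /= sub0r normrN.
rewrite (le_lt_trans (norm_le_enorm _))//.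
rewrite (le_lt_trans (enorm_snd_le_pair_norm (rollout S x1 U j, U`_j)))//.
by rewrite (lt_le_trans (small j jN))// ge_min lexx orbT.
Qed.

(** * The closed loop *)

Section ClosedLoop.
Context (x : nat -> 'cV[R]_n) (u : nat -> 'cV[R]_m).
Context (U : nat -> nat -> controls S).
Context (loop : closed_loop x u U) (fwd : feasible_with_descent x u U).
Let J k := Jbar S (dyn S (x k, u k)) (applied U k).

(** The first stage of the rollout that defines [J k] is the next extended
    state of the closed loop. *)
Lemma next_state_inputE k :
  (dyn S (x k, u k), (applied U k)`_0) = (x k.+1, u k.+1).
Proof. by rewrite (cl_state loop) (cl_input loop). Qed.

Lemma stage_cost_le_J k : stage_cost S (x k.+1, u k.+1) <= 2 * J k.
Proof.
rewrite -next_state_inputE.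
apply: (stage_cost_le_Jbar _ (applied U k) (j := 0%N)).
by rewrite -ltnS prednK// ltnW.
Qed.

Lemma J_decreases k : J k.+1 <= J k - 2^-1 * stage_cost S (x k.+1, u k.+1).
Proof.
have [feas descent] := fwd.
apply: le_trans (descent k.+1 isT) _.
rewrite -next_state_inputE.
exact: Jbar_shifted_le (feas k).
Qed.

Lemma J_nonincreasing : nonincreasing_seq J.
Proof.
apply/nonincreasing_seqP => k; apply: le_trans (J_decreases k) _.
by rewrite gerBl mulr_ge0// ?invr_ge0// stage_cost_ge0.
Qed.

(** The stage costs are squeezed between 0 and twice the decrements of the
    convergent sequence [J]. *)
Lemma stage_cost_cvg0 :
  (fun k => stage_cost S (x k.+1, u k.+1)) @ \oo --> (0 : R).
Proof.
have J_cvg : cvgn J.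
  apply: nonincreasing_is_cvgn; first exact: J_nonincreasing.
  by exists 0 => _ [k _ <-]; exact: Jbar_ge0.
have gap_cvg : (fun k => 2 * (J k - J k.+1)) @ \oo --> (0 : R).
  rewrite -[X in _ --> X](mulr0 2) -[X in 2 * X](subrr (limn J)).
  apply: cvgMr; apply: cvgB; first exact: J_cvg.
  by rewrite (cvg_shiftS J).
apply: squeeze_cvgr (cvg_cst 0) gap_cvg; near=> k.
rewrite stage_cost_ge0/=; have := J_decreases k; lra.
Unshelve. all: by end_near.
Qed.

Lemma closed_loop_cvg0 : converges_to_0 x u.
Proof.
have [c c0 coer] := stage_cost_coercive.
apply/cvgr0Pnorm_lt => e e0.
have [N _ small] : \forall k \near \oo,
    stage_cost S (x k.+1, u k.+1) < e ^+ 2 / c.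
  by apply: (cvgr_lt _ stage_cost_cvg0); rewrite divr_gt0// exprn_gt0.
exists N.+1 => // -[//|k] /= Nk.
have := small k Nk; rewrite ltr_pdivlMr// => {}small.
rewrite (le_lt_trans (norm_le_pair_norm _))//.
rewrite -ltr_sqr ?nnegrE ?pair_norm_ge0 ?(ltW e0)//.
by rewrite (le_lt_trans (coer _))// mulrC.
Qed.

End ClosedLoop.
End Lyapunov.

(** * Convergence and asymptotic stability *)

Unset Implicit Arguments.
Set Strict Implicit.
Set Printing Implicit Defensive.

Theorem theorem3 (R : realType) (n m : nat) (S : mpc_data R n m)
  (hell : (2 <= ell S)%N) (hrho : (1 <= maxit S)%N) (htol : 0 < tol S)
  (hX : closed (stateset S) /\ polyhedral (stateset S))
  (hU : closed (inputset S) /\ polyhedral (inputset S))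
  (hQ : posdef (Qw S)) (hR : posdef (Rw S))
  (hP : stabilizing_riccati_solution S)
  (hterm : terminal_conditions S)
  (hA1 : C1 (sysA S) /\ C1 (sysB S) /\
     exists LA LB : R, [/\ 0 < LA, 0 < LB,
       lipschitz_coef (sysA S) LA & lipschitz_coef (sysB S) LB])
  (hA2 : exists a b : R, [/\ 0 < a, 0 < b,
       forall z, opnorm (sysA S z) <= a & forall z, opnorm (sysB S z) <= b])
  (hA3 : stabilizable (A0 S) (B0 S) /\
     exists2 Qh, is_sqrt_mx (Qw S) Qh & detectable (A0 S) Qh)
  (h0X : interior (stateset S) 0) (h0U : interior (inputset S) 0) :
  (forall x u (U : nat -> nat -> controls S),
     closed_loop x u U -> feasible_with_descent x u U ->
     Fset S (x 0%N, u 0%N) -> feasible_at x u U 0 ->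
     converges_to_0 x u)
  /\
  ((forall x u (U : nat -> nat -> controls S),
      closed_loop x u U ->
      Fset S (x 0%N, u 0%N) -> feasible_at x u U 0 ->
      feasible_with_descent x u U) ->
   (exists2 cV : R, 0 < cV &
      \forall z0 \near nbhs ((0, 0) : 'cV[R]_n * 'cV[R]_m),
        forall x u (U : nat -> nat -> controls S),
          closed_loop x u U -> (x 0%N, u 0%N) = z0 ->
          Jbar S (dyn S z0) (applied U 0%N) <= cV * pair_norm z0 ^+ 2) ->
   asymptotically_stable S).
Proof.
have P_pos : posdef (Pf S) by case: hP.
split=> [x u U loop fwd _ _|init_fwd [cV cV0 J0_bound]].
  exact: (closed_loop_cvg0 hell hQ hR P_pos hterm loop fwd).
have [c c0 coer] := stage_cost_coercive hQ hR.
have [r r0 cheap_feasible] := feasible_of_Jbar_lt hQ hR P_pos hterm h0X h0U.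
have [d0 d0_gt0 J0_le] := ball_pair_norm J0_bound.
(* Within [sqrt (r / cV)] of 0 the bound [cV * |z_0|^2] is below [r]. *)
pose d := Num.min d0 (Num.sqrt (r / cV)).
have d_gt0 : 0 < d by rewrite lt_min d0_gt0 sqrtr_gt0 divr_gt0.
have d_le_d0 : d <= d0 by rewrite ge_min lexx.
have fwd x u (U : nat -> nat -> controls S) : closed_loop x u U ->
    pair_norm (x 0%N, u 0%N) < d -> feasible_with_descent x u U.
  move=> loop; rewrite lt_min => /andP[z0d0 z0r].
  have feas0 : feasible_at x u U 0%N.
    apply: cheap_feasible.
    rewrite (le_lt_trans (J0_le _ z0d0 x u U loop erefl))//.
    rewrite mulrC -ltr_pdivlMr// -[ltRHS]sqr_sqrtr ?divr_ge0 ?ltW//.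
    by rewrite ltr_sqr ?nnegrE ?pair_norm_ge0 ?sqrtr_ge0.
  apply: init_fwd => //.
  have [[xX uU] xNf] := feas0.
  by exists (applied U 0%N); split=> // j /ltnW; exact: xX.
clearbody d; split=> [e e0|]; last first.
  exists d => // x u U loop z0d.
  exact: (closed_loop_cvg0 hell hQ hR P_pos hterm loop (fwd _ _ _ loop z0d)).
pose K := c * (2 * cV).
have K0 : 0 < K by rewrite !mulr_gt0.
(* The estimate [|z_{k+1}|^2 <= K * |z_0|^2] says nothing about step 0, for
   which the bound [e] itself is included in the minimum. *)
exists (Num.min d (Num.min e (e / Num.sqrt K))) => [|x u U loop].
  by rewrite !lt_min d_gt0 e0 divr_gt0 ?sqrtr_gt0.
rewrite !lt_min => /and3P[z0d z0e z0K] [//|k].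
have J_le k' : Jbar S (dyn S (x k', u k')) (applied U k')
    <= Jbar S (dyn S (x 0%N, u 0%N)) (applied U 0%N).
  have := J_nonincreasing hell hQ hR hterm loop (fwd _ _ _ loop z0d).
  by move/(_ _ _ (leq0n k')).
rewrite -ltr_sqr ?nnegrE ?pair_norm_ge0 ?(ltW e0)//.
apply: (@le_lt_trans _ _ (K * pair_norm (x 0%N, u 0%N) ^+ 2)).
  rewrite (le_trans (coer _))// /K -mulrA ler_pM2l//.
  rewrite (le_trans (stage_cost_le_J hell hQ hR P_pos loop k))//.
  rewrite -mulrA ler_pM2l// (le_trans (J_le k))//.
  apply: (J0_le (x 0%N, u 0%N) _ x u U) => //.
  exact: lt_le_trans z0d d_le_d0.
rewrite mulrC -ltr_pdivlMr// -[K in ltRHS]sqr_sqrtr ?ltW// -expr_div_n.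
by rewrite ltr_sqr ?nnegrE ?pair_norm_ge0 ?divr_ge0 ?sqrtr_ge0 ?ltW.
Qed.
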